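(* Let $\hat G$ be a graph, and let $\hat\Sigma$ and $\hat{\mathcal Q}$ be two sets of node-disjoint paths in $\hat G$ (a path of $\hat\Sigma$ may intersect a path of $\hat{\mathcal Q}$). Let $\hat w,\hat D>0$ be integers such that $(\hat\Sigma,\hat{\mathcal Q})$ is $(4\hat w,2\hat D)$-intersecting and $\hat D\geq 8\hat w$. Then there is a collection $\mathcal C$ of pairwise vertex-disjoint subgraphs of $\hat G$ and a subset $\hat\Sigma'\subseteq\hat\Sigma$ such that: every $C\in\mathcal C$ is happy; $|\hat\Sigma'|\geq|\hat\Sigma|/4$; and every path $\sigma\in\hat\Sigma'$ belongs to $\hat\Sigma(C)$ for some $C\in\mathcal C$.
   Context: Two paths intersect if they share a vertex. A pair $(\mathcal R,\mathcal Q)$ of sets of node-disjoint paths is $(w,D)$-intersecting if each path of $\mathcal R$ intersects at least $w$ distinct paths of $\mathcal Q$ and each path of $\mathcal Q$ intersects at least $D$ distinct paths of $\mathcal R$. For a subgraph $C\subseteq\hat G$, $\hat\Sigma(C)$ is the set of paths $\sigma\in\hat\Sigma$ with $\sigma\subseteq C$, and $\Gamma(C)$ is the set of endpoints of the paths of $\hat\Sigma(C)$. A vertex set $T$ is $\hat w$-weakly well-linked in a graph $C$ if for any two disjoint $T',T''\subseteq T$ there are $\min(|T'|,|T''|,\hat w)$ edge-disjoint paths in $C$ connecting vertices of $T'$ to vertices of $T''$. A subgraph $C$ is happy if $\Gamma(C)$ is $\hat w$-weakly well-linked in $C$ and $|\hat\Sigma(C)|\geq\hat D$. *)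

(* Defs.v *)
From HB Require Import structures.
From mathcomp Require Import all_boot finmap.

Set Implicit Arguments.
Unset Strict Implicit.
Unset Printing Implicit Defensive.

(* Finite simple graphs whose vertices form a subset of an ambient finite type;
   a graph and all its subgraphs thus have the same type. *)
Definition graph_axiom (V : finType) (H : {set V} * {set {set V}}) : bool :=
  [forall f in H.2, (#|f| == 2) && (f \subset H.1)].

Record graph (V : finType) :=
  Graph { graph_val : {set V} * {set {set V}}; _ : graph_axiom graph_val }.

HB.instance Definition _ (V : finType) := [isSub for @graph_val V].
HB.instance Definition _ (V : finType) := [Countable of graph V by <:].
HB.instance Definition _ (V : finType) := [Finite of graph V by <:].

Section Graphs.
Variable V : finType.
Implicit Types (G C : graph V) (s p q : seq V) (S R Q : {fset seq V}).

Definition vertices G : {set V} := (val G).1.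
Definition edges G : {set {set V}} := (val G).2.

Definition subgraph C G : bool :=
  (vertices C \subset vertices G) && (edges C \subset edges G).

Definition adj G : rel V := fun x y => [set x; y] \in edges G.

(* A path is the sequence of its vertices; one-vertex paths are allowed.  The
   orientation is immaterial, and distinct nonempty sequences with disjoint
   vertex sets are distinct as undirected paths. *)
Definition is_path G s : bool :=
  if s is x :: p then [&& x \in vertices G, path (adj G) x p & uniq s]
  else false.

Definition path_vertices s : {set V} := [set x in s].

Definition path_edges s : {set {set V}} :=
  if s is x :: p then [set f in pairmap (fun a b => [set a; b]) x p] else set0.

Definition endpoints s : {set V} :=
  if s is x :: p then [set x; last x p] else set0.

Definition node_disjoint_paths G S : Prop :=
  (forall s, s \in S -> is_path G s) /\
  (forall p q, p \in S -> q \in S -> p != q ->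
     [disjoint path_vertices p & path_vertices q]).

Definition intersects p q : bool :=
  ~~ [disjoint path_vertices p & path_vertices q].

Definition intersecting (w D : nat) R Q : Prop :=
  (forall r, r \in R -> w <= #|` [fset q in Q | intersects r q]%fset|) /\
  (forall q, q \in Q -> D <= #|` [fset r in R | intersects q r]%fset|).

Definition path_sub s C : bool :=
  (path_vertices s \subset vertices C) && (path_edges s \subset edges C).

Definition paths_in S C : {fset seq V} := [fset s in S | path_sub s C]%fset.

Definition Gamma S C : {set V} := \bigcup_(s <- paths_in S C) endpoints s.

Definition connects (A B : {set V}) s : bool :=
  if s is x :: p then (x \in A) && (last x p \in B) else false.

Definition weakly_well_linked (w : nat) (T : {set V}) C : Prop :=
  forall A B : {set V}, A \subset T -> B \subset T -> [disjoint A & B] ->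
  exists P : {fset seq V},
    [/\ #|` P| = minn (minn #|A| #|B|) w,
        forall s, s \in P -> is_path C s && connects A B s
      & forall p q, p \in P -> q \in P -> p != q ->
          [disjoint path_edges p & path_edges q]].

Definition happy (w D : nat) S C : Prop :=
  weakly_well_linked w (Gamma S C) C /\ D <= #|` paths_in S C|.

End Graphs.

(* Main.v *)
Require Import Defs.
From mathcomp Require Import all_boot finmap zify.
Set Implicit Arguments.
Unset Strict Implicit.
Unset Printing Implicit Defensive.

(** Partition the vertex set into as many clusters as possible, subject to each
    cluster containing a path of Sigma and to fewer than w edges between clusters
    per split.  A cluster that is not w-weakly well-linked has, by Menger, a cut
    of size less than w and less than the number of terminals on either side;
    such a cut leaves a path of Sigma uncut on both sides, so the cluster could
    be split.  A cluster with fewer than D paths has at least 4w boundary edges,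
    because each of the 4w paths of Q meeting one of its paths either leaves the
    cluster or meets D paths of Sigma that do.  Hence at most half of the clusters
    are small, and the paths inside small clusters and the cut paths are together
    at most twice as many as the paths inside the large ones. *)

(** Pigeonhole: [#|d|] elements that cover [#|d|] labels use each of them once and no other. It is
    needed for tight cuts, which have exactly as many edges as there are labels. *)
Lemma onto_labels (T : finType) (d : {set T}) (l : T -> nat) :
  (forall i, i < #|d| -> exists2 e, e \in d & l e = i) ->
  {in d &, injective l} /\ {in d, forall e, l e < #|d|}.
Proof.
move=> onto; pose s := map l (enum d).
have sub : {subset iota 0 #|d| <= s}.
  move=> i; rewrite mem_iota => /onto[e ed <-].
  by apply: map_f; rewrite mem_enum.
have sz : size s <= size (iota 0 #|d|) by rewrite size_iota size_map -cardE.
split; first exact/dinjectiveP/(leq_size_uniq (iota_uniq _ _) sub sz).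
move=> e ed; have [_ eq_s] := uniq_min_size (iota_uniq _ _) sub sz.
have : l e \in iota 0 #|d| by rewrite eq_s map_f ?mem_enum.
by rewrite mem_iota.
Qed.

(** * Edge cuts and Menger's theorem in terms of edge labellings *)

Section Cuts.
Variable V : finType.
Implicit Types (X Y A B : {set V}) (e f : {set V}) (E P : {set {set V}}) (k : nat).

Definition crosses Y e : bool := ~~ [disjoint e & Y] && ~~ (e \subset Y).

Definition cut E Y : {set {set V}} := [set e in E | crosses Y e].

Lemma crossesP Y e :
  reflect (exists u v, [/\ u \in e, v \in e, u \in Y & v \notin Y]) (crosses Y e).
Proof.
apply: (iffP andP) => [[/pred0Pn[u /andP[ue uY]] /subsetPn[v ve vY]]|].
  by exists u, v.
move=> [u [v [ue ve uY vY]]]; split; first by apply/pred0Pn; exists u; apply/andP.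
by apply/subsetPn; exists v.
Qed.

Lemma crossesC Y e : crosses (~: Y) e = crosses Y e.
Proof.
by apply/crossesP/crossesP => -[u [v [ue ve]]]; rewrite ?inE ?negbK => *;
  exists v, u; rewrite ?inE ?negbK.
Qed.

Lemma cutC E Y : cut E (~: Y) = cut E Y.
Proof. by apply/setP => e; rewrite !inE crossesC. Qed.

Lemma mem_cut E Y e u v :
  e \in E -> u \in e -> v \in e -> u \in Y -> v \notin Y -> e \in cut E Y.
Proof.
by move=> eE ue ve uY vY; rewrite inE eE; apply/crossesP; exists u, v.
Qed.

Lemma cutP E Y e :
  e \in cut E Y -> exists u v, [/\ e \in E, u \in e, v \in e, u \in Y & v \notin Y].
Proof.
by rewrite inE => /andP[eE /crossesP[u [v [*]]]]; exists u, v.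
Qed.

Lemma crosses2 Y x y : crosses Y [set x; y] = (x \in Y) (+) (y \in Y).
Proof.
apply/crossesP/idP => [[a [b []]]|].
  by rewrite !inE => /orP[]/eqP-> /orP[]/eqP-> => [->|->|+ /negbTE->|->]// /negbTE // ->.
case xY: (x \in Y); case yY: (y \in Y) => //= _; [exists x, y|exists y, x];
  by rewrite !inE !eqxx xY yY orbT.
Qed.

Lemma card2_eq e u v : #|e| = 2 -> u \in e -> v \in e -> u != v -> e = [set u; v].
Proof.
move=> e2 ue ve uv; apply/esym/eqP; rewrite eqEcard cards2 uv e2 /= andbT.
by apply/subsetP => z; rewrite !inE => /orP[] /eqP->.
Qed.

Definition separates A B Y : bool := (A \subset Y) && [disjoint Y & B].

(* Such a labelling encodes k edge-disjoint paths from A to B: the edges of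
   each label meet all cuts, hence connect A to B. *)
Definition cut_labelling E A B k (l : {set V} -> nat) : Prop :=
  forall i Y, i < k -> separates A B Y -> exists2 e, e \in cut E Y & l e = i.

Definition min_cut_ge E A B k : Prop :=
  forall Y, separates A B Y -> k <= #|cut E Y|.

(* Cutting along a tight cut X: the labels on both sides are matched through
   the edges of X, which carry each label exactly once. *)
Lemma glue_labellings E A B X k l1 l2 :
  separates A B X -> #|cut E X| = k ->
  cut_labelling [set e in E | ~~ [disjoint e & X]] A (~: X) k l1 ->
  cut_labelling [set e in E | ~~ (e \subset X)] X B k l2 ->
  exists l, cut_labelling E A B k l.
Proof.
move=> /andP[AX XB] cX lab1 lab2.
set d := cut E X in cX.
have on1 i : i < #|d| -> exists2 e, e \in d & l1 e = i.
  rewrite cX => ik; have [|e] := lab1 i X ik.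
    by rewrite /separates AX -setI_eq0 setICr /=.
  by rewrite !inE => /andP[/andP[eE _] eX] <-; exists e; rewrite // inE eE.
have on2 i : i < #|d| -> exists2 e, e \in d & l2 e = i.
  rewrite cX => ik; have [|e] := lab2 i X ik; first by rewrite /separates subxx.
  by rewrite !inE => /andP[/andP[eE _] eX] <-; exists e; rewrite // inE eE.
have [inj1 _] := onto_labels on1; have [inj2 lt2] := onto_labels on2.
(* Edges missing [X] have their [l2] label translated to the [l1] label of the edge of [d] that
   shares it. The default [0] is reached only when [l2 e] is not below [k]. *)
pose l e := if [disjoint e & X]
  then if [pick g in d | l2 g == l2 e] is Some g then l1 g else 0 else l1 e.
exists l => i Y ik /andP[AY YB].
have [g gd g1] := on1 i (eq_ind_r (fun n => i < n) ik cX).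
have jk : l2 g < k by rewrite -cX lt2.
have lE e : e \in E -> ~~ (e \subset X) -> l2 e = l2 g -> l e = i.
  move=> eE eX e2; rewrite /l; case: ifP => [_|/negbT dX].
    case: pickP => [h /andP[hd /eqP h2]|/(_ g)]; last by rewrite gd e2 eqxx.
    by rewrite -g1; congr l1; apply: inj2; rewrite ?h2.
  have ed : e \in d by rewrite inE eE /crosses dX.
  by rewrite -g1; congr l1; apply: inj2.
(* The two labellings are tested on [Y :&: X] and [Y :|: X]. If neither edge obtained is directly
   seen to cross [Y] with label [i], both lie in [d], and injectivity identifies both with [g],
   which then crosses [Y]. *)
have [|e1 ce1 le1] := lab1 i (Y :&: X) ik.
  by rewrite /separates subsetI AY AX disjoints_subset setCK subsetIr.
have [|e2 ce2 le2] := lab2 (l2 g) (Y :|: X) jk.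
  rewrite /separates subsetUr disjoints_subset subUset -!disjoints_subset.
  by rewrite YB XB.
move: (cutP ce1) => [u [v []]].
rewrite !inE => /andP[e1E e1X] ue ve /andP[uY uX] vYX.
case vX : (v \in X) vYX; rewrite ?andbT => vY.
  by exists e1; [exact: (mem_cut e1E ue ve)|rewrite /l (negbTE e1X)].
move: (cutP ce2) => [u' [v' []]].
rewrite !inE negb_or => /andP[e2E e2X] ue' ve' uYX /andP[vY' vX'].
have l_e2 := lE _ e2E e2X le2.
case uY' : (u' \in Y) uYX => /= uX'.
  by exists e2; first exact: (mem_cut e2E ue' ve').
have e2d : e2 \in d by exact: (mem_cut e2E ue' ve').
have e1d : e1 \in d by apply: (mem_cut e1E ue ve); rewrite ?vX.
have e12 : e1 = e2.
  transitivity g; first by apply: inj1; rewrite // le1.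
  exact/esym/inj2.
by exists e2; first by apply: (mem_cut e2E _ ve' uY vY'); rewrite -e12.
Qed.

(* A set P meeting each cut once, such as the edge set of a path of length at
   most 2, can serve as one colour class. *)
Lemma peel_labelling E A B P k l :
  P \subset E ->
  (forall Y, separates A B Y -> exists2 e, e \in P & crosses Y e) ->
  cut_labelling (E :\: P) A B k l -> exists l', cut_labelling E A B k.+1 l'.
Proof.
move=> PE Pcut lab; exists (fun e => if e \in P then k else l e) => i Y.
rewrite ltnS leq_eqVlt => /orP[/eqP-> sY|ik sY].
  have [e eP eY] := Pcut Y sY.
  by exists e; rewrite ?eP // inE (subsetP PE _ eP).
have [e] := lab i Y ik sY; rewrite !inE => /andP[/andP[eP eE] eY] <-.
by exists e; rewrite ?inE ?eE ?(negbTE eP).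
Qed.

(** Deleting [P] costs each separating cut at most one edge. *)
Lemma peel_min_cut E A B P k :
  (forall Y, separates A B Y -> #|cut P Y| <= 1) ->
  min_cut_ge E A B k.+1 -> min_cut_ge (E :\: P) A B k.
Proof.
move=> P1 Ek Y sY.
have : cut E Y \subset cut (E :\: P) Y :|: cut P Y.
  by apply/subsetP => e; rewrite !inE => /andP[-> ->]; case: (e \in P).
move=> /subset_leq_card/leq_trans/(_ (leq_card_setU _ _)).
have := P1 Y sY; have := Ek Y sY; lia.
Qed.

(** Induction on the number of edges. A path from [A] to [B] with one or two edges is peeled off as
    a colour class. Otherwise some edge avoids both [A] and [B]: it is deleted if all cuts stay
    large enough, and if not it lies on a tight cut, along which the graph is divided into two
    smaller instances. *)
Theorem menger_labelling E A B k :
  (forall e, e \in E -> #|e| = 2) -> min_cut_ge E A B k ->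
  exists l, cut_labelling E A B k l.
Proof.
have [n le_n] := ubnP #|E|.
elim: n E A B k le_n => // n IH E A B [|k] le_n E2 Ek; first by exists (fun=> 0).
have IHP E' A' B' k' : E' \proper E -> min_cut_ge E' A' B' k' ->
    exists l, cut_labelling E' A' B' k' l.
  move=> pE; apply: IH; last by move=> e /(subsetP (proper_sub pE)) /E2.
  by apply: leq_trans (proper_card pE) _; rewrite -ltnS.
have [AB|nAB] := boolP [disjoint A & B]; last first.
  exists (fun=> 0) => i Y _ /andP[AY YB]; case/negP: nAB.
  exact: disjointWl AY YB.
have peel P : P \subset E -> P != set0 ->
    (forall Y, separates A B Y -> #|cut P Y| = 1) ->
    exists l, cut_labelling E A B k.+1 l.
  move=> PE P0 P1; have [||l lab] := IHP (E :\: P) A B k.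
  - rewrite properE subsetDl; have /set0Pn[e eP] := P0.
    apply/subsetPn; exists e; first exact: (subsetP PE).
    by rewrite inE eP.
  - by apply: peel_min_cut Ek => Y /P1->.
  - apply: peel_labelling PE _ lab => Y /P1/eqP/cards1P[e eP].
    have : e \in cut P Y by rewrite eP set11.
    by rewrite inE => /andP[]; exists e.
(* [Y0] consists of [A] and its neighbours outside [B]. An edge leaving [Y0] therefore completes a
   path of length one or two from [A] to [B], or has both ends outside [A] and [B]. *)
pose Y0 := A :|: [set v | (v \notin B) && [exists a in A, [set a; v] \in E]].
have sY0 : separates A B Y0.
  rewrite /separates subsetUl disjoints_subset subUset -disjoints_subset AB.
  by apply/subsetP => v; rewrite !inE => /andP[].
have /card_gt0P[f /cutP[u [v [fE uf vf uY vY]]]] : 0 < #|cut E Y0|.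
  exact: leq_trans (Ek _ sY0).
have uv : u != v by apply: contraNneq vY => <-.
have f_eq := card2_eq (E2 _ fE) uf vf uv.
have vA : v \notin A by apply: contra vY; rewrite inE => ->.
have sepA Y a : separates A B Y -> a \in A -> a \in Y.
  by move=> /andP[/subsetP + _] => h /h.
have sepB Y b : separates A B Y -> b \in B -> b \notin Y.
  by move=> /andP[_ +] bB; rewrite disjoint_sym => /disjointFr ->.
have [uA|uA] := boolP (u \in A).
  have vB : v \in B.
    apply: contraR vY => vB; rewrite !inE vB /=; apply/orP; right.
    by apply/existsP; exists u; rewrite uA -f_eq.
  apply: (peel [set f]); rewrite ?sub1set //.
    by apply/set0Pn; exists f; rewrite set11.
  move=> Y sY; apply/eqP/cards1P; exists f; apply/setP => e; rewrite !inE.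
  case: eqP => // ->; rewrite f_eq crosses2 (sepA _ _ sY uA).
  by rewrite (negbTE (sepB _ _ sY vB)).
move: uY; rewrite !inE (negbTE uA) /= => /andP[uB /exists_inP[a aA auE]].
have [vB|vB] := boolP (v \in B).
  apply: (peel [set [set a; u]; f]).
  - by apply/subsetP => e; rewrite !inE => /orP[]/eqP->.
  - by apply/set0Pn; exists f; rewrite !inE eqxx orbT.
  move=> Y sY; have aY := sepA _ _ sY aA; have bY := sepB _ _ sY vB.
  apply/eqP/cards1P; exists (if u \in Y then f else [set a; u]).
  apply/setP => e; rewrite !inE andb_orl; case: ifP => uY.
    case: (e =P f) => [->|_]; rewrite ?orbT ?andbT ?orbF.
      by rewrite f_eq crosses2 uY (negbTE bY) orbT.
    by case: eqP => //= ->; rewrite crosses2 aY uY.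
  case: (e =P [set a; u]) => [->|_] /=; first by rewrite crosses2 aY uY.
  by case: eqP => //= ->; rewrite f_eq crosses2 uY (negbTE bY).
(* From here on [f] meets neither [A] nor [B]; either it can be deleted, or some cut [X] through it
   has exactly [k.+1] edges. *)
have [/forallP del|/forallPn[X]] :=
    boolP [forall Y, separates A B Y ==> (k < #|cut (E :\ f) Y|)].
  have [|Y sY|l lab] := IHP (E :\ f) A B k.+1; first exact: properD1.
    by have := del Y; rewrite sY.
  exists l => i Y ik sY; have [e] := lab i Y ik sY.
  by rewrite !inE => /andP[/andP[_ eE] eY] <-; exists e; rewrite ?inE ?eE.
rewrite negb_imply -leqNgt => /andP[sX cX].
have fX : f \in cut E X.
  apply: contraTT (Ek X sX) => fX; rewrite -leqNgt; apply: leq_trans cX.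
  apply/subset_leq_card/subsetP => e; rewrite !inE => /andP[eE eX].
  by rewrite eE eX !andbT; apply: contraNneq fX => <-; rewrite inE eE.
have tight : #|cut E X| = k.+1.
  apply/eqP; rewrite eqn_leq Ek // andbT (cardsD1 f) fX add1n ltnS.
  apply: leq_trans cX; apply/subset_leq_card/subsetP => e.
  by rewrite !inE => /and3P[-> -> ->].
have [x [y [_ xf yf xX yX]]] := cutP fX.
have xy : x != y by apply: contraNneq yX => <-.
have fxy := card2_eq (E2 _ fE) xf yf xy.
have notA z : z \in f -> z \notin A by rewrite f_eq !inE => /orP[]/eqP->.
have notB z : z \in f -> z \notin B by rewrite f_eq !inE => /orP[]/eqP->.
have /andP[AX XB] := sX.
(* No separating cut fits inside the tight cut without [f]. If all edges met [X], moving [y] into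
   [X] would produce such a cut; if none lay inside [X], removing [x] from [X] would. Hence both
   sides have fewer edges than [E]. *)
have smaller Y : separates A B Y -> ~~ (cut E Y \subset cut E X :\ f).
  move=> sY; apply: contraL (Ek Y sY) => /subset_leq_card; rewrite -leqNgt.
  by move: tight; rewrite (cardsD1 f) fX add1n => -[->].
have p1 : [set e in E | ~~ [disjoint e & X]] \proper E.
  rewrite properE; apply/andP; split.
    by apply/subsetP => e; rewrite inE => /andP[].
  apply: contra (smaller (y |: X) _) => [/subsetP sub|].
    apply/subsetP => e /cutP[s [t [eE se te]]]; rewrite !inE negb_or eE.
    move=> syX /andP[ty tX]; apply/andP; split.
      apply: contraTneq te => ->; rewrite fxy !inE (negbTE ty) orbF.
      by apply: contraNneq tX => ->.
    rewrite /crosses; have := sub e eE; rewrite inE eE /= => -> /=.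
    by apply/subsetPn; exists t.
  rewrite /separates (subset_trans AX (subsetUr _ _)) /=.
  by rewrite disjoints_subset subUset sub1set inE notB // -disjoints_subset.
have p2 : [set e in E | ~~ (e \subset X)] \proper E.
  rewrite properE; apply/andP; split.
    by apply/subsetP => e; rewrite inE => /andP[].
  apply: contra (smaller (X :\ x) _) => [/subsetP sub|].
    apply/subsetP => e /cutP[s [t [eE se te]]]; rewrite !inE negb_and negbK eE.
    move=> /andP[sx sX'] tx; apply/andP; split.
      apply: contraTneq se => ->; rewrite fxy !inE (negbTE sx) /=.
      by apply: contraNneq yX => <-.
    rewrite /crosses; have := sub e eE; rewrite inE eE /= => ->.
    by rewrite andbT; apply/pred0Pn; exists s; apply/andP.
  rewrite /separates (disjointWl (subsetDl _ _)) // andbT.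
  by rewrite subsetD1 AX notA.
have [|l1 lab1] := IHP _ A (~: X) k.+1 p1.
  move=> Y /andP[AY YX]; have YsX : Y \subset X.
    by move: YX; rewrite disjoints_subset setCK.
  apply: leq_trans (Ek Y _) _; first by rewrite /separates AY (disjointWl YsX).
  apply/subset_leq_card/subsetP => e /cutP[s [t [eE se te sY tY]]].
  apply: (mem_cut _ se te) => //; rewrite inE eE.
  by apply/pred0Pn; exists s; rewrite /= se (subsetP YsX).
have [|l2 lab2] := IHP _ X B k.+1 p2.
  move=> Y /andP[XY YB].
  apply: leq_trans (Ek Y _) _; first by rewrite /separates YB (subset_trans AX).
  apply/subset_leq_card/subsetP => e /cutP[s [t [eE se te sY tY]]].
  apply: (mem_cut _ se te) => //; rewrite inE eE.
  by apply/subsetPn; exists t => //; apply: contra tY => /(subsetP XY).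
exact: glue_labellings sX tight lab1 lab2.
Qed.

End Cuts.

(** * Paths crossing cuts, and well-linkedness from cut conditions *)

Section Paths.
Variable V : finType.
Implicit Types (G C : graph V) (X Y T : {set V}) (e : {set V}).
Implicit Types (s p : seq V) (S R : {fset seq V}) (x y z : V).

Lemma edge_card G e : e \in edges G -> #|e| = 2.
Proof. by move=> eG; have /forall_inP/(_ e eG)/andP[/eqP] := valP G. Qed.

Lemma edge_sub G e : e \in edges G -> e \subset vertices G.
Proof. by move=> eG; have /forall_inP/(_ e eG)/andP[] := valP G. Qed.

Lemma mem_pairmap_path (r : rel V) x p e :
  path r x p -> e \in pairmap (fun a b => [set a; b]) x p ->
  exists u v, [/\ e = [set u; v], r u v, u \in x :: p & v \in x :: p].
Proof.
elim: p x => //= y p IHp x /andP[rxy rp]; rewrite inE => /orP[/eqP->|ep].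
  by exists x, y; rewrite !inE !eqxx orbT.
have [u [v [-> ruv up vp]]] := IHp y rp ep.
by exists u, v; split; rewrite // inE ?up ?vp orbT.
Qed.

Lemma mem_path_edges s e :
  e \in path_edges s -> exists u v, [/\ e = [set u; v], u \in s & v \in s].
Proof.
case: s => [|x p]; rewrite inE // => ep.
have rp : path (fun _ _ => true) x p by elim: p x {ep} => //=.
by have [u [v [-> _ us vs]]] := mem_pairmap_path rp ep; exists u, v.
Qed.

Lemma path_edges_vertices s e : e \in path_edges s -> e \subset path_vertices s.
Proof.
move=> /mem_path_edges[u [v [-> us vs]]].
by apply/subsetP => z; rewrite !inE => /orP[]/eqP->.
Qed.

Lemma is_path_edges G s : is_path G s -> path_edges s \subset edges G.
Proof.
case: s => //= x p /and3P[_ rp _]; apply/subsetP => e; rewrite inE => ep.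
by have [u [v [-> ruv _ _]]] := mem_pairmap_path rp ep.
Qed.

Lemma is_path_vertices G s : is_path G s -> path_vertices s \subset vertices G.
Proof.
case: s => //= x p /and3P[xG rp _]; apply/subsetP => z; rewrite inE => zp.
elim: p x xG rp zp => [|y p IHp] x xG /=; first by rewrite inE => _ /eqP->.
move=> /andP[rxy rp]; rewrite inE => /orP[/eqP->//|]; apply: IHp => //.
by apply: (subsetP (edge_sub rxy)); rewrite !inE eqxx orbT.
Qed.

Lemma disjoint_path_edges p s :
  [disjoint path_vertices p & path_vertices s] ->
  [disjoint path_edges p & path_edges s].
Proof.
move=> ps; apply/pred0Pn => -[e /andP[/= ep es]].
have [u [v [eE up _]]] := mem_path_edges ep.
have := subsetP (path_edges_vertices es) u; rewrite eE !inE eqxx => /(_ isT) us.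
by have := disjointFr ps (x := u); rewrite !inE up us => /(_ isT).
Qed.

Lemma path_crosses_last X x p :
  (x \in X) != (last x p \in X) ->
  exists2 e, e \in path_edges (x :: p) & crosses X e.
Proof.
elim: p x => /= [|y p IHp] x; first by rewrite eqxx.
have [xy|xy] := eqVneq (x \in X) (y \in X).
  rewrite xy => /IHp[e]; rewrite !inE => ep eX.
  by exists e; rewrite ?inE ?ep ?orbT.
by exists [set x; y]; rewrite ?crosses2 ?inE ?eqxx //; case: (x \in X) (y \in X) xy => [] [].
Qed.

Lemma path_crosses X s y z :
  y \in s -> z \in s -> y \in X -> z \notin X ->
  exists2 e, e \in path_edges s & crosses X e.
Proof.
case: s => // x p yp zp yX zX.
(* One of [y] and [z] lies on the other side of [X] from the first vertex [x], so the initial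
   segment up to it crosses. *)
suff [t tp xt] : exists2 t, t \in x :: p & (x \in X) != (t \in X).
  case/splitPl: tp xt => p1 p2 <- /path_crosses_last[e]; rewrite !inE => ep eX.
  by exists e; rewrite ?inE ?pairmap_cat ?mem_cat ?ep.
by case xX: (x \in X); [exists z; rewrite ?(negbTE zX)|exists y; rewrite ?yX].
Qed.

Lemma is_path_cut G X s y z :
  is_path G s -> y \in s -> z \in s -> y \in X -> z \notin X ->
  exists2 e, e \in path_edges s & e \in cut (edges G) X.
Proof.
move=> Gs ys zs yX zX; have [e es eX] := path_crosses ys zs yX zX.
by exists e; rewrite // inE eX (subsetP (is_path_edges Gs)).
Qed.

(* A path with both endpoints in X that leaves X crosses the cut at least
   twice: before and after its visit outside X. *)
Lemma card_endpoints_cut X s :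
  uniq s -> ~~ (path_vertices s \subset X) ->
  #|endpoints s :&: X| <= #|cut (path_edges s) X|.
Proof.
case: s => [|x p] us /subsetPn[y]; rewrite inE // => yp yX.
case/splitPl: yp us => p1 p2 ly us; rewrite /= last_cat ly.
set z := last y p2; set F := cut _ X.
have cross1 : x \in X ->
    exists2 e, e \in F & e \in path_edges (x :: p1).
  move=> xX; have [|e ep eX] := @path_crosses_last X x p1.
    by rewrite ly xX (negbTE yX).
  by exists e; rewrite // inE eX; move: ep; rewrite !inE pairmap_cat mem_cat => ->.
have cross2 : z \in X ->
    exists2 e, e \in F & e \in path_edges (y :: p2).
  move=> zX; have [|e ep eX] := @path_crosses_last X y p2.
    by rewrite -/z zX (negbTE yX).
  exists e; rewrite // inE eX; move: ep.
  by rewrite !inE pairmap_cat mem_cat ly => ->; rewrite orbT.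
have card1 t : #|[set t] :&: X| = (t \in X).
  have [tX|tX] := boolP (t \in X); last by apply/eqP; rewrite cards_eq0 setI_eq0 disjoints1.
  by rewrite (setIidPl _) ?sub1set ?cards1.
have : #|[set x; z] :&: X| <= (x \in X) + (z \in X).
  by rewrite setIUl -!card1 leq_card_setU.
move=> /leq_trans; apply.
have [/cross1[e1 F1 p1e]|_] := boolP (x \in X);
  have [/cross2[e2 F2 p2e]|_] := boolP (z \in X) => //.
(* If the two halves shared the crossing edge, its end in [X] would lie on both halves. They share
   only [y], which is outside [X]. *)
- have [e12|e12] := eqVneq e1 e2; last first.
    have -> : true + true = #|[set e1; e2]| by rewrite cards2 e12.
    by apply/subset_leq_card; rewrite subUset !sub1set F1 F2.
  rewrite -{}e12 {e2} in F2 p2e.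
  have [u [v [_ ue _ uX _]]] := cutP F1.
  have := subsetP (path_edges_vertices p1e) u ue.
  have := subsetP (path_edges_vertices p2e) u ue.
  rewrite [u \in _]inE [u \in path_vertices _]inE inE => /orP[/eqP uy|u2 u1].
    by rewrite -uy uX in yX.
  move: us; rewrite -cat_cons cat_uniq => /and3P[_ /hasPn/(_ u u2)].
  by rewrite u1.
- by rewrite addn0; apply/card_gt0P; exists e1.
- by apply/card_gt0P; exists e2.
Qed.

Lemma sum_card_disjoint (I : eqType) (T : finType) (r : seq I)
    (F : I -> {set T}) (U : {set T}) :
  uniq r -> {in r, forall i, F i \subset U} ->
  {in r &, forall i j, i != j -> [disjoint F i & F j]} ->
  \sum_(i <- r) #|F i| <= #|U|.
Proof.
elim: r U => [|i r IHr] U; first by rewrite big_nil.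
move=> /= /andP[ir ur] FU Fd; rewrite big_cons -(cardsID (F i) U).
rewrite (setIidPr _) ?FU ?mem_head // leq_add2l.
apply: IHr => // [j jr|j k jr kr]; last by apply: Fd; rewrite inE ?jr ?kr orbT.
rewrite subsetD FU ?inE ?jr ?orbT //; apply: Fd; rewrite ?inE ?eqxx ?jr ?orbT //.
by apply: contraNneq ir => <-.
Qed.

(** Node-disjoint paths have disjoint edge sets, so each path of [R] has its own edges in [U]. *)
Lemma card_crossing_paths G S (R : seq (seq V)) (U : {set {set V}}) :
  node_disjoint_paths G S -> uniq R -> {subset R <= S} ->
  (forall s, s \in R -> exists2 e, e \in path_edges s & e \in U) ->
  size R <= #|U|.
Proof.
move=> [_ dS] uR RS RU; apply: leq_trans (sum_card_disjoint (F := fun s => path_edges s :&: U) uR _ _).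
- rewrite -sum1_size [leqLHS]big_seq [leqRHS]big_seq; apply: leq_sum => s /RU[e es eU].
  by apply/card_gt0P; exists e; rewrite inE es.
- by move=> s _; exact: subsetIr.
- move=> p s pR sR ps; apply: disjointWl (subsetIl _ _) _.
  apply: disjointWr (subsetIl _ _) _; apply: disjoint_path_edges.
  by apply: dS; rewrite ?RS.
Qed.

(** If every path of [S] in [C] left [X], each would put at least as many edges into the cut as it
    has endpoints in [X]. These edges are distinct for distinct paths, so the cut would be at least
    as large as the set of terminals in [X]. *)
Lemma path_within_of_small_cut G C S X :
  node_disjoint_paths G S ->
  #|cut (edges C) X| < #|Gamma S C :&: X| ->
  exists2 s, s \in paths_in S C & path_vertices s \subset X.
Proof.
move=> [pS dS]; have [/hasP[s sS sX] _|/hasPn out] :=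
  boolP (has (fun s => path_vertices s \subset X) (paths_in S C)).
  by exists s.
rewrite ltnNge => /negP[].
have sub s : s \in paths_in S C -> s \in S /\ path_sub s C.
  by rewrite !inE => /andP[].
apply: (@leq_trans (\sum_(s <- paths_in S C) #|cut (path_edges s) X|)).
  rewrite /Gamma; apply: (@leq_trans (\sum_(s <- paths_in S C) #|endpoints s :&: X|)).
    elim: (enum_fset _) => [|s r IHr]; first by rewrite !big_nil set0I cards0.
    rewrite !big_cons setIUl (leq_trans (leq_card_setU _ _)) //.
    by rewrite leq_add2l.
  rewrite [leqLHS]big_seq [leqRHS]big_seq; apply: leq_sum => s sC.
  have [/pS] := sub s sC; case: s sC => // x p sC /and3P[_ _ us] _.
  exact: card_endpoints_cut us (out _ sC).
apply: sum_card_disjoint => [|s|p s]; first exact: fset_uniq.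
  move=> /sub[_ /andP[_ sC]]; apply/subsetP => e; rewrite !inE => /andP[es ->].
  by rewrite (subsetP sC).
move=> /sub[pin _] /sub[sin _] ps; have := disjoint_path_edges (dS _ _ pin sin ps).
apply: disjointW.
  by apply/subsetP => e; rewrite inE => /andP[].
by apply/subsetP => e; rewrite inE => /andP[].
Qed.

(** The labelled form of Menger's theorem is turned into paths: each label class connects [A] to
    [B], and paths taken from different classes are edge-disjoint. *)
Lemma weakly_well_linked_of_cuts C w T :
  T \subset vertices C ->
  (forall X, minn (minn #|T :&: X| #|T :\: X|) w <= #|cut (edges C) X|) ->
  weakly_well_linked w T C.
Proof.
move=> TC cuts A B AT BT AB; set k := minn _ _.
have [||l lab] := @menger_labelling V (edges C) A B k.
- exact: edge_card.
- move=> Y /andP[AY YB]; apply: leq_trans (cuts Y).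
  have leA : #|A| <= #|T :&: Y| by rewrite subset_leq_card // subsetI AT.
  have leB : #|B| <= #|T :\: Y|.
    by rewrite subset_leq_card // subsetD BT disjoint_sym.
  rewrite /k; lia.
have path_i (i : 'I_k) : exists s, [/\ is_path C s, connects A B s,
    path_edges s != set0 & forall e, e \in path_edges s -> l e = i].
  pose r x y := ([set x; y] \in edges C) && (l [set x; y] == i).
  (* [Y] is what [A] reaches along edges labelled [i]. If it missed [B], it would be a separating
     set, and some edge labelled [i] would leave it. *)
  pose Y := [set y | [exists a in A, connect r a y]].
  have AY : A \subset Y.
    by apply/subsetP => a aA; rewrite inE; apply/exists_inP; exists a.
  have [YB|] := boolP [disjoint Y & B].
    have [|e ce le] := lab i Y (ltn_ord i); first by rewrite /separates AY.
    have [u [v [eC ue ve uY vY]]] := cutP ce.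
    have uv : u != v by apply: contraNneq vY => <-.
    case/negP: vY; move: uY; rewrite !inE => /exists_inP[a aA au].
    apply/exists_inP; exists a => //; apply: connect_trans au (connect1 _).
    by rewrite /r -(card2_eq (edge_card eC) ue ve uv) eC le eqxx.
  move=> /pred0Pn[b /andP[/=]]; rewrite inE => /exists_inP[a aA /connectP[p0 rp0 eb]] bB.
  rewrite {}eb in bB; case: (shortenP rp0) bB => p rp up _ bB.
  exists (a :: p); split=> [|||e].
  - rewrite /is_path (subsetP TC) ?(subsetP AT) // up andbT /=.
    by apply: sub_path rp => x y /andP[].
  - by rewrite /= aA.
  - case: p {rp up} bB => [|y p] /= aB; first by rewrite (disjointFr AB) in aB.
    by apply/set0Pn; exists [set a; y]; rewrite !inE eqxx.
  - rewrite inE => ep; have [u [v [-> /andP[_ /eqP] //]]] := mem_pairmap_path rp ep.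
have [f fP] := fin_all_exists path_i.
(* Each path has an edge because [A] and [B] are disjoint, and that edge reveals the label. So the
   [k] labels give [k] distinct paths. *)
have inj_f : injective f.
  move=> i j fij; have [_ _ /set0Pn[e ei] li] := fP i.
  have [_ _ _ lj] := fP j; apply/val_inj.
  by rewrite /= -(li e ei) (lj e) // -fij.
exists [fset f i | i in 'I_k]%fset; split.
- by rewrite card_imfset //= -cardE card_ord.
- by move=> s /imfsetP[i _ ->]; have [-> ->] := fP i.
move=> p q /imfsetP[i _ ->] /imfsetP[j _ ->] fij.
apply/pred0Pn => -[e /andP[/= ei ej]]; case/eqP: fij; congr f; apply/val_inj.
have [_ _ _ li] := fP i; have [_ _ _ lj] := fP j.
by rewrite /= -(li e ei) (lj e).
Qed.

End Paths.

(** * Induced subgraphs and the boundary of small clusters *)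

Section Clusters.
Variable V : finType.
Implicit Types (G C : graph V) (X Y : {set V}) (s : seq V) (S Q : {fset seq V}).

Definition induced_val G X : {set V} * {set {set V}} :=
  (vertices G :&: X, [set e in edges G | e \subset X]).

Lemma induced_axiom G X : graph_axiom (induced_val G X).
Proof.
apply/forall_inP => e; rewrite inE => /andP[eG eX].
by rewrite (edge_card eG) eqxx subsetI (edge_sub eG).
Qed.

Definition induced G X : graph V := Graph (induced_axiom G X).

Lemma induced_subgraph G X : subgraph (induced G X) G.
Proof.
apply/andP; split; first exact: subsetIl.
by apply/subsetP => e; rewrite inE => /andP[].
Qed.

Lemma path_sub_induced G X s :
  is_path G s -> path_sub s (induced G X) = (path_vertices s \subset X).
Proof.
move=> Gs; rewrite /path_sub subsetI is_path_vertices //=.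
case: (boolP (_ \subset X)) => //= sX; apply/subsetP => e es.
rewrite inE (subsetP (is_path_edges Gs)) //=.
exact: subset_trans (path_edges_vertices es) sX.
Qed.

Lemma mem_paths_in_induced G S X s :
  node_disjoint_paths G S ->
  (s \in paths_in S (induced G X)) = (s \in S) && (path_vertices s \subset X).
Proof.
move=> [pS _]; rewrite !inE /=; case: (boolP (s \in S)) => //= sS.
exact: path_sub_induced (pS s sS).
Qed.

Lemma Gamma_sub S C : Gamma S C \subset vertices C.
Proof.
rewrite /Gamma big_seq; apply: (big_ind (fun X : {set V} => X \subset _)).
- exact: sub0set.
- by move=> X Y XC YC; rewrite subUset XC.
move=> s; rewrite !inE => /andP[_ /andP[sC _]]; apply: subset_trans sC.
case: s => [|x p]; first exact: sub0set.
apply/subsetP => z; rewrite !inE => /orP[]/eqP->; first by rewrite eqxx.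
by rewrite -in_cons mem_last.
Qed.

Lemma is_path_neq0 G s : is_path G s -> exists x, x \in s.
Proof. by case: s => // x p _; exists x; rewrite mem_head. Qed.

Lemma card_fset_sum (T : choiceType) (A : {fset T}) (P : pred T) :
  #|` [fset s in A | P s]%fset| = \sum_(s <- A) P s.
Proof.
have /perm_size-> : perm_eq [fset s in A | P s]%fset (filter P A).
  apply: uniq_perm; rewrite ?filter_uniq ?fset_uniq // => s.
  by rewrite mem_filter !inE andbC.
rewrite size_filter -sum1_count big_mkcond /=.
by apply: eq_bigr => s _; case: (P s).
Qed.

(* Few paths of S lie inside X, so a path of Q either leaves X or meets at
   least D paths of S that do. *)
Lemma small_cluster_boundary G S Q w D X s :
  node_disjoint_paths G S -> node_disjoint_paths G Q ->
  intersecting (4 * w) (2 * D) S Q -> 8 * w <= D ->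
  s \in S -> path_vertices s \subset X ->
  #|` paths_in S (induced G X)| < D -> 4 * w <= #|cut (edges G) X|.
Proof.
move=> dS dQ [intS intQ] wD sS sX small.
have leaves p (t : {set V}) : is_path G p -> t \subset X -> ~~ [disjoint path_vertices p & t] ->
    ~~ (path_vertices p \subset X) ->
    exists2 e, e \in path_edges p & e \in cut (edges G) X.
  move=> Gp tX /pred0Pn[y /andP[/= yp yt]] /subsetPn[z zp zX].
  move: yp zp; rewrite !inE => yp zp.
  exact: (is_path_cut Gp yp zp (subsetP tX y yt)).
set Qs := [fset q in Q | intersects s q]%fset in intS *.
have QsP q : q \in Qs -> q \in Q /\ intersects s q by rewrite !inE => /andP[].
have [/allP out|/allPn[q /QsP[qQ sq]]] :=
    boolP (all (fun q => ~~ (path_vertices q \subset X)) Qs).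
  apply: leq_trans (intS s sS) _.
  apply: (card_crossing_paths dQ) => [||q qs]; first exact: fset_uniq.
    by move=> q /QsP[].
  have [qQ sq] := QsP q qs; apply: (leaves q (path_vertices s)); rewrite ?out //.
    exact: dQ.1.
  by rewrite disjoint_sym.
rewrite negbK => qX; have := intQ q qQ.
set Sq := [fset r in S | intersects q r]%fset.
rewrite -(cardfsID (paths_in S (induced G X))) => le_Sq.
(* Of at least [2 * D] paths meeting [q], fewer than [D] stay in [X]; more than [D], hence more than
   [4 * w], cross the boundary. *)
suff : #|` (Sq `\` paths_in S (induced G X))%fset| <= #|cut (edges G) X|.
  have : #|` (Sq `&` paths_in S (induced G X))%fset| <= #|` paths_in S (induced G X)|.
    exact/fsubset_leq_card/fsubsetIr.
  lia.
apply: (card_crossing_paths dS) => [||r]; first exact: fset_uniq.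
  by move=> r; rewrite !inE => /andP[_ /andP[]].
rewrite in_fsetD mem_paths_in_induced // => /andP[rX].
rewrite !inE /= => /andP[rS qr]; rewrite rS /= in rX.
apply: (leaves r (path_vertices q)); rewrite 1?disjoint_sym //.
exact: dS.1.
Qed.

(** * Colourings with few bichromatic edges, and their refinement *)

Definition bichromatic G (c : V -> nat) : {set {set V}} :=
  [set e in edges G | [exists x in e, [exists y in e, c x != c y]]].

Definition colour (c : V -> nat) i : {set V} := [set x | c x == i].

(* The colour classes are the clusters; every split of a cluster creates one
   more class and at most w - 1 bichromatic edges. *)
Definition sparse_colouring G S w (c : V -> nat) r : Prop :=
  [/\ forall x, c x < r,
      forall i, i < r -> exists2 s, s \in S & path_vertices s \subset colour c i
    & #|bichromatic G c| <= r.-1 * w.-1].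

(** The part of class [i] in [X] receives the new colour [r]. The cut is smaller than the number of
    terminals on either side, so [path_within_of_small_cut] supplies a path of [S] in both parts. *)
Lemma split_colouring G S w c r i X :
  node_disjoint_paths G S -> sparse_colouring G S w c r -> i < r ->
  let C := induced G (colour c i) in
  #|cut (edges C) X| < minn (minn #|Gamma S C :&: X| #|Gamma S C :\: X|) w ->
  exists c', sparse_colouring G S w c' r.+1.
Proof.
move=> dS [cr cS cG] ir C; rewrite !leq_min => /andP[/andP[XI XD] Xw].
exists (fun x => if (c x == i) && (x \in X) then r else c x); split.
- by move=> x; case: ifP => // _; rewrite ltnS ltnW.
- move=> j; rewrite ltnS leq_eqVlt => /orP[/eqP->|jr].
    have [s] := path_within_of_small_cut dS XI.
    rewrite mem_paths_in_induced // => /andP[sS /subsetP si] /subsetP sX.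
    exists s => //; apply/subsetP => x xs.
    by have := si x xs; rewrite !inE => ->; rewrite sX ?eqxx.
  have [->|ji] := eqVneq j i.
    have [|s] := path_within_of_small_cut (C := C) (X := ~: X) dS.
      by rewrite cutC -setDE.
    rewrite mem_paths_in_induced // => /andP[sS /subsetP si] /subsetP sX.
    exists s => //; apply/subsetP => x xs.
    have := si x xs; have := sX x xs; rewrite !inE => /negbTE-> ci.
    by rewrite andbF.
  have [s sS /subsetP si] := cS j jr; exists s => //; apply/subsetP => x xs.
  have := si x xs; rewrite !inE => /eqP->.
  by rewrite (negbTE ji) /= eqxx.
set c' := fun x => _.
(* A newly bichromatic edge was inside class [i] and has exactly one end in [X]. *)
have : bichromatic G c' \subset bichromatic G c :|: cut (edges C) X.
  apply/subsetP => e; rewrite inE => /andP[eG /exists_inP[x xe /exists_inP[y ye]]].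
  rewrite /c' => cxy; rewrite inE; case: (boolP (e \in bichromatic G c)) => //=.
  rewrite inE eG /= => /exists_inPn mono.
  have same z : z \in e -> c z = c x.
    by move=> ze; have /exists_inPn/(_ z ze) := mono x xe; rewrite negbK => /eqP.
  move: cxy; rewrite (same y ye); case: (c x =P i) => [ci|_]; last by rewrite eqxx.
  have eC : e \in edges C.
    by rewrite inE eG; apply/subsetP => z ze; rewrite inE same ?ci.
  case xX: (x \in X); case yX: (y \in X); rewrite ?eqxx //= => _.
    by apply: (mem_cut eC xe ye); rewrite ?yX.
  by apply: (mem_cut eC ye xe); rewrite ?xX.
move=> /subset_leq_card/leq_trans; apply.
apply: leq_trans (leq_card_setU _ _) _.
(* [i < r] excludes [r = 0], so [r.-1] really grows by one and pays for the at most [w.-1] new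
   edges. *)
case: r cG ir {cr cS c' } => // r; nia.
Qed.

(** Every colour below [r] occurs on a vertex, since its class contains a nonempty path. *)
Lemma sparse_colouring_le G S w c r :
  node_disjoint_paths G S -> sparse_colouring G S w c r -> r <= #|V|.
Proof.
move=> [pS _] [_ cS _]; rewrite -(size_iota 0 r) cardE -(size_map c).
apply: uniq_leq_size (iota_uniq _ _) _ => i; rewrite mem_iota => /cS[s sS si].
have [x xs] := is_path_neq0 (pS s sS).
have := subsetP si x; rewrite !inE => /(_ xs)/eqP<-.
by rewrite map_f ?mem_enum.
Qed.

(** A class violating the cut condition is split; this terminates because the number of classes
    never exceeds [#|V|]. *)
Lemma maximal_colouring G S w c r :
  node_disjoint_paths G S -> sparse_colouring G S w c r ->
  exists c' r', [/\ r <= r', sparse_colouring G S w c' r'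
    & forall i, i < r' -> weakly_well_linked w
        (Gamma S (induced G (colour c' i))) (induced G (colour c' i))].
Proof.
move=> dS; have [n] := ubnP (#|V| - r).
elim: n c r => // n IH c r; rewrite ltnS => le_n cr.
pose ok (i : 'I_r) X := let C := induced G (colour c i) in
  minn (minn #|Gamma S C :&: X| #|Gamma S C :\: X|) w <= #|cut (edges C) X|.
have [/forallP wl|/forallPn[i /forallPn[X]]] :=
    boolP [forall i, [forall X, ok i X]].
  exists c, r; split=> // i ir; apply: weakly_well_linked_of_cuts => [|X].
    exact: Gamma_sub.
  exact: (forallP (wl (Ordinal ir)) X).
rewrite -ltnNge => bad; have [c1 cr1] := split_colouring dS cr (ltn_ord i) bad.
have := sparse_colouring_le dS cr1 => lt_r.
have [|c2 [r2 [le2 cr2 wl2]]] := IH c1 r.+1 _ cr1; first by lia.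
by exists c2, r2; split=> //; apply: leq_trans le2.
Qed.

(** Double counting: a bichromatic edge can only be in the cuts of the colours of its two ends, and
    a monochromatic edge is in none. *)
Lemma sum_cut_colours G c r :
  \sum_(i < r) #|cut (edges G) (colour c i)| <= 2 * #|bichromatic G c|.
Proof.
have cross (i : 'I_r) : #|cut (edges G) (colour c i)|
    = \sum_(e in edges G) crosses (colour c i) e.
  rewrite -sum1_card big_mkcond [RHS]big_mkcond; apply: eq_bigr => e _.
  by rewrite inE; case: (e \in _).
rewrite (eq_bigr _ (fun i _ => cross i)) exchange_big /= mulnC -sum_nat_const.
rewrite big_mkcond [leqRHS]big_mkcond; apply: leq_sum => e _.
rewrite inE; case: (boolP (e \in edges G)) => //= eG.
have /cards2P[x [y [xy e_eq]]] : #|e| == 2 by rewrite (edge_card eG).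
case: ifPn => [_|/exists_inPn mono]; last first.
  rewrite big1 // => i _; apply/eqP; rewrite eqb0; apply/crossesP.
  move=> [u [v [ue ve]]]; rewrite !inE => /eqP <- /eqP; apply.
  by have /exists_inPn/(_ v ve) := mono u ue; rewrite negbK => /eqP.
have card1 z : \sum_(i < r) (c z == i) <= 1.
  have [zr|zr] := ltnP (c z) r.
    rewrite (bigD1 (Ordinal zr)) //= eqxx big1 // => i.
    by rewrite -val_eqE /= eq_sym => /negbTE->.
  by rewrite big1 // => i _; case: eqP => // zi; rewrite zi leqNgt ltn_ord in zr.
apply: leq_trans (leq_add (card1 x) (card1 y)).
rewrite -big_split /=; apply: leq_sum => i _.
by rewrite e_eq crosses2 !inE; case: (c x == i); case: (c y == i).
Qed.

(* With g large and b small clusters, [few] gives 2 * b < r, so b <= g. *)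
Lemma four_fold_bound w D g b r m n N :
  0 < w -> 8 * w <= D -> g + b = r ->
  b * (4 * w) <= 2 * (r.-1 * w.-1) -> g * D <= n -> m <= r.-1 * w.-1 ->
  N <= n + b * D + m -> N <= 4 * n.
Proof.
move=> w_gt0 wD gb few gn m_le N_le.
have le_w : r.-1 * w.-1 <= r.-1 * w by rewrite leq_mul2l leq_pred orbT.
have : 2 * b * w <= r.-1 * w by lia.
rewrite leq_pmul2r // => b_le.
have bD : b * D <= g * D by rewrite leq_mul2r; apply/orP; right; lia.
(* From [b <= g] follows [r.-1 <= 2 * g]. As [8 * g * w <= g * D <= n], the term [b * D] is at most
   [n] and [m] at most a quarter of [n]. *)
have : r.-1 * w <= 2 * g * w by rewrite leq_mul2r; apply/orP; right; lia.
have : g * (8 * w) <= g * D by rewrite leq_mul2l wD orbT.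
lia.
Qed.

End Clusters.

(** * Selecting the large clusters and counting the paths they contain *)

Theorem theorem4p16 (V : finType) (G : graph V) (Sigma Q : {fset seq V})
    (w D : nat)
    (hSigma : node_disjoint_paths G Sigma) (hQ : node_disjoint_paths G Q)
    (hw : 0 < w) (hD : 0 < D)
    (hint : intersecting (4 * w) (2 * D) Sigma Q)
    (hDw : 8 * w <= D) :
  exists (CC : {set graph V}) (Sigma' : {fset seq V}),
    (forall C, C \in CC -> subgraph C G) /\
    (forall C1 C2, C1 \in CC -> C2 \in CC -> C1 != C2 ->
       [disjoint vertices C1 & vertices C2]) /\
    (Sigma' `<=` Sigma)%fset /\
    (forall C, C \in CC -> happy w D Sigma C) /\
    #|` Sigma| <= 4 * #|` Sigma'| /\
    (forall s, s \in Sigma' -> exists2 C, C \in CC & s \in paths_in Sigma C).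
Proof.
(* The empty case is separate because the initial one-class colouring must contain a path of
   [Sigma]. *)
have [->|[s0 s0S]] := fset_0Vmem Sigma.
  exists set0, fset0; rewrite cardfs0 fsub0set.
  split=> [C|]; first by rewrite inE.
  split=> [C1 C2|]; first by rewrite inE.
  split=> //; split=> [C|]; first by rewrite inE.
  by split=> // s; rewrite inE.
have [|c [r [r_gt0 [cr cS cG] wl]]] :=
    @maximal_colouring V G Sigma w (fun=> 0) 1 hSigma.
  split=> // [i|]; first by rewrite ltnS leqn0 => /eqP->; exists s0;
    rewrite // /colour; apply/subsetP => x; rewrite inE.
  rewrite mul0n leqn0 cards_eq0; apply/eqP/setP => e; rewrite !inE.
  by apply/negP => /andP[_ /exists_inP[x _ /exists_inP[y _]]]; rewrite eqxx.
pose C i := induced G (colour c i).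
pose good i := D <= #|` paths_in Sigma (C i)|.
pose inside s i := path_vertices s \subset colour c i.
pose Sigma' := [fset s in Sigma | [exists i : 'I_r, good i && inside s i]]%fset.
have memC s i : s \in paths_in Sigma (C i) = (s \in Sigma) && inside s i.
  exact: mem_paths_in_induced.
have inside_eq s i x : inside s i -> x \in s -> i = c x.
  by move=> /subsetP/(_ x); rewrite !inE => h /h/eqP.
exists [set C i | i : 'I_r & good i], Sigma'; split; [|split; [|split; [|split; [|split]]]].
- by move=> _ /imsetP[i _ ->]; exact: induced_subgraph.
- move=> _ _ /imsetP[i _ ->] /imsetP[j _ ->] ij.
  apply/pred0Pn => -[x /andP[/=]]; rewrite !inE => /andP[_ /eqP xi] /andP[_ /eqP xj].
  by rewrite -xi -xj eqxx in ij.
- by apply/fsubsetP => s; rewrite !inE => /andP[].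
- move=> _ /imsetP[i + ->]; rewrite inE => gi; split=> //.
  exact: wl (ltn_ord i).
- have card_in i : #|` paths_in Sigma (C i)| = \sum_(s <- Sigma) inside s i.
    rewrite -card_fset_sum; congr #|` _|; apply/fsetP => s.
    by rewrite memC !inE.
  (* Paths are nonempty and colour classes disjoint, so no path is counted for two clusters. *)
  have bound_good : \sum_(i < r | good i) D <= #|` Sigma'|.
    apply: (@leq_trans (\sum_(i < r | good i) #|` paths_in Sigma (C i)|)).
      exact: leq_sum.
    under eq_bigr do rewrite card_in; rewrite exchange_big card_fset_sum /=.
    rewrite big_seq [leqRHS]big_seq; apply: leq_sum => s sS.
    have [x xs] := is_path_neq0 (hSigma.1 s sS).
    have [/existsP[i /andP[gi si]]|/existsPn none] :=
        boolP [exists i : 'I_r, good i && inside s i].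
      rewrite (bigD1 i) //= si big1 // => j /andP[_ ji].
      apply/eqP; rewrite eqb0; apply: contra ji => sj; apply/eqP/val_inj.
      by rewrite /= (inside_eq _ _ _ sj xs) (inside_eq _ _ _ si xs).
    rewrite big1 // => i gi; apply/eqP; rewrite eqb0.
    by have := none i; rewrite gi.
  have bound_all : #|` Sigma| <=
      #|` Sigma'| + \sum_(i < r | ~~ good i) D + #|bichromatic G c|.
    (* Each path lies in a good class, in a bad class, or in no class; a path of the last kind
       contains a bichromatic edge of its own. *)
    pose in_bad s := [exists i : 'I_r, ~~ good i && inside s i].
    pose cut_off s := ~~ [exists i : 'I_r, inside s i].
    apply: (@leq_trans (\sum_(s <- Sigma)
        ((s \in Sigma') + in_bad s + cut_off s))).
      rewrite -sum1_size big_seq [leqRHS]big_seq; apply: leq_sum => s sS.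
      rewrite /cut_off; case: existsP => [[i si]|_]; last by rewrite addn1.
      rewrite !inE sS /=; case gi: (good i).
        suff -> : [exists i : 'I_r, good i && inside s i] by [].
        by apply/existsP; exists i; rewrite gi.
      suff -> : in_bad s by rewrite addn1.
      by apply/existsP; exists i; rewrite gi.
    rewrite !big_split /=; apply: leq_add; first apply: leq_add.
    - rewrite -card_fset_sum; apply/fsubset_leq_card/fsubsetP => s.
      by rewrite inE => /andP[].
    - apply: (@leq_trans (\sum_(i < r | ~~ good i) #|` paths_in Sigma (C i)|)).
        under [leqRHS]eq_bigr do rewrite card_in; rewrite [leqRHS]exchange_big /=.
        apply: leq_sum => s _; rewrite /in_bad; case: existsP => // -[i /andP[gi si]].
        by rewrite (bigD1 i) //= si.
      by apply: leq_sum => i; rewrite /good -ltnNge => /ltnW.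
    rewrite -card_fset_sum; apply: (card_crossing_paths hSigma) => [||s].
    - exact: fset_uniq.
    - by move=> s; rewrite inE => /andP[].
    rewrite inE /= => /andP[sS /existsPn out].
    have [x xs] := is_path_neq0 (hSigma.1 s sS).
    have /subsetPn[z zs zx] := out (Ordinal (cr x)).
    have [|||e es /cutP[u [v [eG ue ve]]]] :=
        @is_path_cut V G (colour c (c x)) s x z (hSigma.1 s sS) xs.
    - by move: zs; rewrite inE.
    - by rewrite inE.
    - exact: zx.
    rewrite !inE => /eqP cu cv; exists e; rewrite // inE eG /=.
    apply/exists_inP; exists u => //; apply/exists_inP; exists v => //.
    by rewrite cu eq_sym.
  have boundary (i : 'I_r) : ~~ good i -> 4 * w <= #|cut (edges G) (colour c i)|.
    rewrite /good -ltnNge => small; have [s sS si] := cS i (ltn_ord i).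
    exact: small_cluster_boundary hSigma hQ hint hDw sS si small.
  (* The boundaries of the bad clusters are bounded by those of all clusters, which count each
     bichromatic edge at most twice. *)
  have few : \sum_(i < r | ~~ good i) 4 * w <= 2 * (r.-1 * w.-1).
    apply: leq_trans (leq_trans (sum_cut_colours G c r) _); last by rewrite leq_mul2l cG.
    by rewrite [leqRHS](bigID (fun i : 'I_r => good i)) /= (leq_trans _ (leq_addl _ _)) // leq_sum.
  move: bound_good bound_all few; rewrite !sum_nat_const.
  have := cardC (fun i : 'I_r => good i); rewrite card_ord.
  move=> gb le_g le_all few.
  exact: four_fold_bound hw hDw gb few le_g cG le_all.
move=> s; rewrite !inE => /andP[sS /existsP[i /andP[gi si]]].
exists (C i); first by apply/imsetP; exists i; rewrite ?inE.
by rewrite memC sS.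
Qed.
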